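(* Let $\mathcal G$ be a weighted graph and $r\geq 2$ an integer, and put $\gamma=\mathcal G(K_2)$. Let $s$ be a positive integer with $\gamma\in\left[\tfrac{s-1}{2s},\tfrac{s}{2(s+1)}\right]$ and let $\alpha\in\left[0,\tfrac1s\right]$ satisfy $\gamma=\tfrac{s}{2(s+1)}(1-\alpha^2)$. Then \[ \mathcal G(K_r)\geq \frac{1}{(s+1)^r}\binom{s+1}{r}(1+\alpha)^{r-1}\bigl(1-(r-1)\alpha\bigr). \]
   Context: For a positive integer $n$ write $[n]=\{1,\dots,n\}$ and, for a set $X$, let $X^{(k)}$ denote the family of $k$-element subsets of $X$. A weighted graph of order $n$ is a pair consisting of a sequence $(x_1,\dots,x_n)$ of non-negative reals with $x_1+\dots+x_n=1$ and a function $\mathcal A:[n]^{(2)}\to[0,1]$. For such $\mathcal G$ and a positive integer $k$, \[ \mathcal G(K_k)=\sum_{M\in[n]^{(k)}}\ \prod_{E\in M^{(2)}}\mathcal A(E)\prod_{i\in M}x_i . \] (One always has $0\le \mathcal G(K_2)<\tfrac12$.) *)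

(* Defs.v *)
From HB Require Import structures.
From mathcomp Require Import all_boot all_order all_algebra.
From mathcomp Require Import reals.

Set Implicit Arguments.
Unset Strict Implicit.
Unset Printing Implicit Defensive.

Import Order.TTheory GRing.Theory Num.Theory.
Local Open Scope ring_scope.

(* The order n is necessarily positive, since the weights sum to 1.
   The edge function is total on {set 'I_n}, but it is constrained, and used
   below, only on the two-element sets. *)
Record wgraph (R : realType) (n : nat) := WGraph {
  vweight : 'I_n -> R;
  eweight : {set 'I_n} -> R;
  vweight_ge0 : forall i, 0 <= vweight i;
  vweight_sum1 : \sum_(i < n) vweight i = 1;
  eweight_itv : forall E : {set 'I_n}, #|E| = 2%N -> eweight E \in `[0, 1]
}.

(* The quantity written G(K_k) for a weighted graph G. *)
Definition clique_density (R : realType) (n : nat) (G : wgraph R n) (k : nat)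
    : R :=
  \sum_(M : {set 'I_n} | #|M| == k)
    (\prod_(E : {set 'I_n} | (E \subset M) && (#|E| == 2%N)) eweight G E) *
    \prod_(i in M) vweight G i.

(* Main.v *)
Require Import Defs.
From HB Require Import structures.
From mathcomp Require Import all_boot all_order all_algebra.
From mathcomp Require Import reals.
From mathcomp Require Import zify ring lra polyrcf.

Set Implicit Arguments.
Unset Strict Implicit.
Unset Printing Implicit Defensive.

Import Order.TTheory GRing.Theory Num.Theory.
Local Open Scope ring_scope.

(* With [s = q + 1] and [r = m + 2], the extremal curve is traced by the graphs
   with s parts of size u and one part of size 1 - s u: they have edge density
   [turan_edges q u], and the slope of the curve at u is C(s-1, r-2) u^(r-2).
   Since the curve is concave, the infimum Phi of its tangents over
   u >= 1/(s+1) extends it to all densities.  Suppose that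
   G(K_r) - Phi(G(K_2)) has a negative minimum over the weighted graphs of
   order n.  At a minimiser every edge lies in a (weighted) number of r-cliques
   at most lambda = Phi'(G(K_2)), and the numbers of r-cliques and of edges
   through a vertex i satisfy t_r(i) = lambda t_2(i) + c with the same c for
   all i.  Combined with a Bonferroni inequality for the vertices missing an
   r-clique, this bounds G(K_(r+1)) - lambda G(K_3) from above.  The link of i
   has exactly t_r(i) cliques of order r - 1, so that the theorem for
   (r - 1, s - 1) bounds its number of edges from above, and then the theorem
   for (r, s - 1) bounds t_(r+1)(i) - lambda t_3(i) from below.  Both t_r and
   the lower bound are affine in t_2(i), so summing over i gives a lower bound
   for G(K_(r+1)) - lambda G(K_3) that contradicts the upper bound. *)

(** * The extremal curve and its tangents *)

Definition turan_edges (R : realType) (q : nat) (u : R) : R :=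
  q.+1%:R * u - q.+1%:R * q.+2%:R / 2 * u ^+ 2.

(* The tangent to the extremal curve at [u], divided by ['C(q, m)]. *)
Definition turan_tangent (R : realType) (m q : nat) (u x : R) : R :=
  u ^+ m * x - m%:R * q.+1%:R / m.+1%:R * u ^+ m.+1
  + m%:R * q.+1%:R * q.+2%:R / (2 * m.+2%:R) * u ^+ m.+2.

Section Tangent.
Variable R : realType.
Implicit Types (m q : nat) (u v x y : R).

Lemma turan_edges_decr q u v : q.+2%:R^-1 <= v -> v < u ->
  turan_edges q u < turan_edges q v.
Proof.
move=> qv vu; have q2 : (0 : R) < q.+2%:R by rewrite ltr0n.
have q1 : (0 : R) < q.+1%:R by rewrite ltr0n.
have {}qv : 1 <= v * q.+2%:R by rewrite -ler_pdivrMr // mul1r.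
rewrite -subr_gt0 /turan_edges.
have -> : q.+1%:R * v - q.+1%:R * q.+2%:R / 2 * v ^+ 2 -
  (q.+1%:R * u - q.+1%:R * q.+2%:R / 2 * u ^+ 2) =
  q.+1%:R * (u - v) * ((v * q.+2%:R - 1) + q.+2%:R * (u - v) / 2) by field.
rewrite !mulr_gt0 ?subr_gt0 // ltr_wpDl ?subr_ge0 //.
by rewrite divr_gt0 // mulr_gt0 // subr_gt0.
Qed.

Lemma turan_edges_le q u v : q.+2%:R^-1 <= v -> v <= u ->
  turan_edges q u <= turan_edges q v.
Proof.
move=> qv; rewrite le_eqVlt => /predU1P[-> //|vu].
exact/ltW/turan_edges_decr.
Qed.

Lemma turan_tangent_affine m q u x y :
  turan_tangent m q u y = turan_tangent m q u x + u ^+ m * (y - x).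
Proof. by rewrite /turan_tangent; ring. Qed.

(* The derivative of [turan_tangent m q u x] in [u] is
   [m * u ^+ m.-1 * (x - turan_edges q u)], which changes sign at [u = v]. *)
Lemma turan_tangent_min m q u v : q.+2%:R^-1 <= u -> q.+2%:R^-1 <= v ->
  turan_tangent m q v (turan_edges q v) <= turan_tangent m q u (turan_edges q v).
Proof.
move=> qu qv; set x := turan_edges q v.
case: m => [|m]; first by rewrite /turan_tangent !mul0r !expr0.
have q2 : (0 : R) < q.+2%:R^-1 by rewrite invr_gt0 ltr0n.
pose p : {poly R} := x *: 'X ^+ m.+1
  - (m.+1%:R * q.+1%:R / m.+2%:R) *: 'X ^+ m.+2
  + (m.+1%:R * q.+1%:R * q.+2%:R / (2 * m.+3%:R)) *: 'X ^+ m.+3.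
have pE w : p.[w] = turan_tangent m.+1 q w x.
  by rewrite /p /turan_tangent !hornerE /= mulrC.
have dpE w : p^`().[w] = m.+1%:R * w ^+ m * (x - turan_edges q w).
  rewrite /p derivD derivB !derivZ !derivXn [_.+1.-1]/= [_.+2.-1]/= [_.+3.-1]/=.
  rewrite !hornerD hornerN !hornerZ !hornerMn !hornerXn /turan_edges.
  have h2 : (m.+2%:R : R) != 0 by rewrite pnatr_eq0.
  have h3 : (m.+3%:R : R) != 0 by rewrite pnatr_eq0.
  rewrite -[w ^+ m *+ m.+1]mulr_natr -[w ^+ m.+1 *+ _]mulr_natr.
  rewrite -[w ^+ m.+2 *+ _]mulr_natr (exprS w m.+1) (exprS w m).
  by field; rewrite -?natrD ?nat1r ?pnatr_eq0.
rewrite -!pE; have [vu|uv] := leP v u.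
  apply: (@ler_hornerW _ v u p); rewrite ?in_itv /= ?lexx ?vu // => w.
  rewrite in_itv /= => /andP[vw wu].
  have w0 : 0 <= w by apply/ltW/(lt_le_trans q2)/(le_trans qv)/ltW.
  rewrite dpE mulr_ge0 ?mulr_ge0 ?exprn_ge0 // subr_ge0.
  by apply: turan_edges_le => //; exact: ltW.
rewrite -lerN2 -!hornerN; apply: (@ler_hornerW _ u v (- p));
  rewrite ?in_itv /= ?lexx ?(ltW uv) // => w.
rewrite in_itv /= => /andP[uw wv].
have w0 : 0 <= w by apply/ltW/(lt_le_trans q2)/(le_trans qu)/ltW.
rewrite derivN hornerN dpE oppr_ge0 mulr_ge0_le0 ?mulr_ge0 ?exprn_ge0 //.
rewrite subr_le0; apply: turan_edges_le; last exact: ltW.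
exact: le_trans qu (ltW uw).
Qed.

(** Multiplied by [m!], both sides become products, compared factor by factor:
    [(q - i)(q + 2) <= (q + 1 - i)(q + 1)], with difference [i + 1]. *)
Lemma bin_expn_mono m q : ('C(q, m) * q.+2 ^ m <= 'C(q.+1, m) * q.+1 ^ m)%N.
Proof.
rewrite -(leq_pmul2l (fact_gt0 m)) !mulnA ![(m`! * _)%N]mulnC !bin_ffact.
elim: m => [//|m IH]; rewrite !ffactnSr !expnSr mulnACA [leqRHS]mulnACA.
rewrite leq_mul //; have [le_qm|lt_mq] := leqP q m.
  by move: le_qm; rewrite -subn_eq0 => /eqP ->.
by rewrite subSn ?(ltnW lt_mq) //; move: (q - m)%N (leq_subr m q) => k; nia.
Qed.

(** Convexity of the kink between two scallops: on the left is the largest slope of scallop [q], at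
    its left end, and on the right a slope of curve [q.+1] at or beyond the left end of its
    scallop. *)
Lemma bin_slope_le m q u : q.+2%:R^-1 <= u ->
  'C(q, m)%:R * q.+1%:R^-1 ^+ m <= 'C(q.+1, m)%:R * u ^+ m.
Proof.
move=> qu; have q1 : (0 : R) < q.+1%:R ^+ m by rewrite exprn_gt0 // ltr0n.
have q2 : (0 : R) < q.+2%:R ^+ m by rewrite exprn_gt0 // ltr0n.
apply: (@le_trans _ _ ('C(q.+1, m)%:R * q.+2%:R^-1 ^+ m)).
  rewrite !exprVn ler_pdivrMr // mulrAC ler_pdivlMr //.
  by rewrite -!natrX -!natrM ler_nat bin_expn_mono.
rewrite ler_wpM2l // lerXn2r // nnegrE ?invr_ge0 //.
by apply: le_trans qu; rewrite invr_ge0.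
Qed.

Lemma bin_succ_ratio m q : 'C(q, m)%:R * q.+1%:R =
  'C(q.+1, m)%:R * (q.+1%:R - m%:R) :> R.
Proof.
have [le_mq|lt_qm] := leqP m q.+1.
  by rewrite -natrB // -!natrM mulnC (mul_bin_down q.+1) mulnC.
by rewrite !bin_small ?mul0r // ltnW.
Qed.

(** Join [q.+1] parts of size [u] to the remaining weight. Edges of a bipartite graph inside the
    remainder change G(K_r) and G(K_2) in the ratio ['C(q.+1, m) * u ^+ m], so the tangent to curve
    [q.+1] at [u] passes through the point of curve [q] at [u]. *)
Lemma bin_tangent_succ m q u :
  'C(q, m)%:R * turan_tangent m q u (turan_edges q u) =
  'C(q.+1, m)%:R * turan_tangent m q.+1 u (turan_edges q u).
Proof.
have -> : 'C(q, m)%:R = 'C(q.+1, m)%:R * (q.+1%:R - m%:R) / q.+1%:R :> R.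
  by rewrite -bin_succ_ratio mulfK // pnatr_eq0.
rewrite /turan_tangent /turan_edges (exprS u m.+1) (exprS u m).
by field; rewrite -?natrD ?nat1r ?pnatr_eq0.
Qed.

(** Both sides are affine in [x]. At [x = turan_edges q u] the left one is a point of curve [q],
    hence below the tangent at [v]; the left one is also steeper, so the inequality persists for
    smaller [x]. *)
Lemma turan_tangent_step m q u v x : q.+2%:R^-1 <= u -> x <= turan_edges q u ->
  q.+2%:R^-1 <= v <= q.+1%:R^-1 ->
  'C(q.+1, m)%:R * turan_tangent m q.+1 u x <=
  'C(q, m)%:R * turan_tangent m q v x.
Proof.
move=> qu xu /andP[qv vq].
rewrite (turan_tangent_affine _ _ u (turan_edges q u) x).
rewrite (turan_tangent_affine _ _ v (turan_edges q u) x).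
rewrite [leLHS]mulrDr [leRHS]mulrDr.
rewrite -bin_tangent_succ lerD ?ler_wpM2l ?ler0n ?turan_tangent_min //.
rewrite !mulrA ler_wnM2r ?subr_le0 //; apply: le_trans (bin_slope_le m qu).
have v0 : 0 <= v by apply: le_trans qv; rewrite invr_ge0.
by rewrite ler_wpM2l // lerXn2r // nnegrE invr_ge0.
Qed.

(** The larger root of [turan_edges q u = x]. Above the maximum of [turan_edges q] the square root
    of a negative number is 0, which clamps the value at the vertex of the parabola. *)
Definition turan_part q x : R :=
  (1 + Num.sqrt (1 - 2 * q.+2%:R / q.+1%:R * x)) / q.+2%:R.

Lemma turan_part_ge q x : q.+2%:R^-1 <= turan_part q x.
Proof. by rewrite ler_pdivlMr ?ltr0n // mulVf ?pnatr_eq0 // lerDl sqrtr_ge0. Qed.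

Lemma turan_edges_inv q :
  turan_edges q (q.+2%:R^-1) = q.+1%:R / (2 * q.+2%:R) :> R.
Proof. by rewrite /turan_edges; field; rewrite -?natrD ?nat1r ?pnatr_eq0. Qed.

Variant turan_part_spec q x : R -> Prop :=
| TuranPartIn u of q.+2%:R^-1 <= u & x = turan_edges q u : turan_part_spec q x u
| TuranPartOut of turan_edges q (q.+2%:R^-1) < x :
    turan_part_spec q x (q.+2%:R^-1).

Lemma turan_partP q x : turan_part_spec q x (turan_part q x).
Proof.
have [le_x|lt_x] := leP x (turan_edges q (q.+2%:R^-1)).
  constructor; first exact: turan_part_ge.
  have s0 : 0 <= 1 - 2 * q.+2%:R / q.+1%:R * x.
    rewrite subr_ge0 mulrAC ler_pdivrMr ?ltr0n // mul1r.
    move: le_x; rewrite turan_edges_inv ler_pdivlMr ?mulr_gt0 ?ltr0n //.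
    by rewrite mulrC.
  rewrite /turan_part /turan_edges; move: (sqr_sqrtr s0).
  set y := Num.sqrt _ => yE.
  have -> : x = q.+1%:R / (2 * q.+2%:R) * (1 - y ^+ 2).
    by rewrite yE; field; rewrite -?natrD ?nat1r ?pnatr_eq0.
  by field; rewrite -?natrD ?nat1r ?pnatr_eq0.
suff -> : turan_part q x = q.+2%:R^-1 by constructor.
rewrite /turan_part ler0_sqrtr ?addr0 ?mul1r // subr_le0.
rewrite mulrAC ler_pdivlMr ?ltr0n // mul1r.
move: lt_x; rewrite turan_edges_inv ltr_pdivrMr ?mulr_gt0 ?ltr0n //.
by rewrite mulrC => /ltW.
Qed.

(** So [turan_part] attains the infimum Phi. Past the maximal density, compare the affine functions
    at that density: the tangent at the clamped value is the lowest there and has the least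
    slope. *)
Lemma turan_tangent_part_min m q u x : q.+2%:R^-1 <= u ->
  turan_tangent m q (turan_part q x) x <= turan_tangent m q u x.
Proof.
case: turan_partP => [v qv -> qu|lt_x qu]; first exact: turan_tangent_min.
set v := q.+2%:R^-1.
rewrite (turan_tangent_affine _ _ v (turan_edges q v) x).
rewrite (turan_tangent_affine _ _ u (turan_edges q v) x).
rewrite lerD ?turan_tangent_min // ler_wpM2r ?subr_ge0 ?(ltW lt_x) //.
by rewrite lerXn2r // nnegrE ?(le_trans _ qu) // invr_ge0.
Qed.

End Tangent.

(** * Weighted clique sums *)

Section CliqueSums.
Variables (R : realType) (n : nat).
Implicit Types (A : {set 'I_n} -> R) (x : 'I_n -> R) (M N : {set 'I_n}).

(** [A] is unconstrained on singletons, so the diagonal is set to 0. Products over [N] then vanish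
    when [i \in N], and [link_cliques] can sum over all [N]. *)
Definition adj A i j := if i == j then 0 else A [set i; j].

Definition clique_weight A x M :=
  (\prod_(E : {set 'I_n} | (E \subset M) && (#|E| == 2%N)) A E)
  * \prod_(i in M) x i.

Definition cliques A x k := \sum_(M : {set 'I_n} | #|M| == k) clique_weight A x M.

Definition cliques_at A x k i :=
  \sum_(M : {set 'I_n} | (#|M| == k) && (i \in M)) clique_weight A x M.

Definition link_cliques A x k i :=
  \sum_(N : {set 'I_n} | #|N| == k)
    clique_weight A x N * \prod_(j in N) adj A i j.

Lemma adjC A i j : adj A i j = adj A j i.
Proof. by rewrite /adj eq_sym setUC. Qed.

Lemma adj_itv A : (forall E : {set 'I_n}, #|E| = 2%N -> A E \in `[0, 1]) ->
  forall i j, 0 <= adj A i j <= 1.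
Proof.
move=> A01 i j; rewrite /adj; have [_|nij] := eqVneq i j.
  by rewrite lexx ler01.
by have := A01 [set i; j]; rewrite cards2 nij in_itv /=; apply.
Qed.

Lemma clique_weightU1 A x i N : i \notin N ->
  clique_weight A x (i |: N) =
  x i * (clique_weight A x N * \prod_(j in N) adj A i j).
Proof.
move=> iN; rewrite /clique_weight big_setU1 //=.
rewrite (bigID (fun E : {set 'I_n} => i \in E)) /=.
have -> : \prod_(E : {set 'I_n} |
    (E \subset i |: N) && (#|E| == 2%N) && (i \in E)) A E =
    \prod_(j in N) adj A i j.
  transitivity (\prod_(E in [set [set i; j] | j in N]) A E).
    apply: eq_bigl => E; apply/idP/imsetP => [/andP[/andP[EN E2] iE]|[j jN ->]].
      have /cards1P[j Ej] : #|E :\ i| == 1%N.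
        by move: E2; rewrite (cardsD1 i) iE.
      have jE : j \in E :\ i by rewrite Ej set11.
      exists j; last by rewrite -(setD1K iE) Ej.
      move: jE; rewrite in_setD1 => /andP[ji jE].
      by move: (subsetP EN _ jE); rewrite in_setU1 (negPf ji).
    have ij : i != j by apply: contraNneq iN => ->.
    by rewrite set21 cards2 ij subUset !sub1set setU11 in_setU1 jN orbT.
  rewrite big_imset /= => [|j k jN kN jk].
    apply: eq_bigr => j jN; rewrite /adj ifN //.
    by apply: contraNneq iN => ->.
  have ij : i != j by apply: contraNneq iN => ->.
  by have := set22 i j; rewrite jk !inE eq_sym (negPf ij) => /eqP.
have -> : \prod_(E : {set 'I_n} |
    (E \subset i |: N) && (#|E| == 2%N) && (i \notin E)) A E =
    \prod_(E : {set 'I_n} | (E \subset N) && (#|E| == 2%N)) A E.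
  apply: eq_bigl => E; rewrite andbAC; congr (_ && _).
  apply/andP/idP => [[/subsetP EiN iE]|EN].
    apply/subsetP => j jE; have := EiN _ jE; rewrite in_setU1.
    by case/predU1P => // ji; rewrite -ji jE in iE.
  split; first by rewrite (subset_trans EN) // subsetUr.
  by apply: contra iN => /(subsetP EN).
by ring.
Qed.

Lemma prod_adj0 A i N : i \in N -> \prod_(j in N) adj A i j = 0.
Proof. by move=> iN; rewrite (bigD1 i) //= /adj eqxx mul0r. Qed.

Lemma link_cliquesE A x k i : link_cliques A x k i =
  \sum_(N : {set 'I_n} | (#|N| == k) && (i \notin N))
    clique_weight A x N * \prod_(j in N) adj A i j.
Proof.
rewrite /link_cliques (bigID (fun N : {set 'I_n} => i \in N)) /= big1 ?add0r //.
by move=> N /andP[_ iN]; rewrite prod_adj0 ?mulr0.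
Qed.

Lemma cliques_atE A x k i :
  cliques_at A x k.+1 i = x i * link_cliques A x k i.
Proof.
rewrite link_cliquesE /cliques_at mulr_sumr.
rewrite (reindex_onto (fun N => i |: N) (fun M => M :\ i)) /= => [|M /andP[_ iM]].
  apply: eq_big => [N|N /andP[/andP[_ _] /eqP NE]].
    rewrite setU11 andbT; have [iN|iN] := boolP (i \in N).
      rewrite andbF; apply/negP => /andP[_ /eqP NE].
      by move: iN; rewrite -NE setD11.
    by rewrite setU1K // eqxx !andbT cardsU1 iN.
  by rewrite clique_weightU1 // -NE setD11.
exact: setD1K.
Qed.

Lemma sum_cliques_at A x k (h : 'I_n -> R) :
  \sum_(M : {set 'I_n} | #|M| == k) clique_weight A x M * (\sum_(i in M) h i)
  = \sum_i h i * cliques_at A x k i.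
Proof.
under eq_bigr => M _ do rewrite mulr_sumr.
rewrite (exchange_big_dep xpredT) //=; apply: eq_bigr => i _.
by rewrite mulr_sumr; apply: eq_bigr => M _; rewrite mulrC.
Qed.

Lemma sum_cliques_at1 A x k :
  \sum_i cliques_at A x k i = k%:R * cliques A x k.
Proof.
transitivity (\sum_i 1 * cliques_at A x k i).
  by apply: eq_bigr => i _; rewrite mul1r.
rewrite -sum_cliques_at /cliques mulr_sumr; apply: eq_bigr => M /eqP cM.
by rewrite sumr_const cM mulrC.
Qed.

Lemma link_cliques1 A x i : link_cliques A x 1 i = \sum_j x j * adj A i j.
Proof.
rewrite /link_cliques.
rewrite (reindex_onto (fun j => [set j]) (fun N => odflt i [pick j in N])) /=;
  last first.
  move=> N /cards1P[j ->]; case: pickP => [k|/(_ j)]; last by rewrite set11.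
  by rewrite inE => /eqP ->.
apply: eq_big => [j|j _].
  rewrite cards1 eqxx /=; case: pickP => [k|/(_ j)]; last by rewrite set11.
  by rewrite inE => /eqP ->; rewrite eqxx.
rewrite /clique_weight !big_set1 big1 ?mul1r // => E /andP[/subset_leq_card].
by rewrite cards1 => E1 /eqP E2; rewrite E2 in E1.
Qed.

Definition cliques_through A x k i j :=
  \sum_(M : {set 'I_n} | [&& #|M| == k, i \in M & j \in M]) clique_weight A x M.

Lemma sum_cliques_through A x k (h : 'I_n -> 'I_n -> R) :
  \sum_(M : {set 'I_n} | #|M| == k)
    clique_weight A x M * (\sum_(i in M) \sum_(j in M | j != i) h i j)
  = \sum_i \sum_(j | j != i) h i j * cliques_through A x k i j.
Proof.
under eq_bigr => M _ do rewrite mulr_sumr.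
rewrite (exchange_big_dep xpredT) //=; apply: eq_bigr => i _.
under eq_bigr => M _ do rewrite mulr_sumr.
rewrite (exchange_big_dep (fun j => j != i)) /=; last by move=> M j _ /andP[].
apply: eq_bigr => j ji; rewrite mulr_sumr; apply: eq_big => [M|M _].
  by rewrite ji andbT andbA.
by rewrite mulrC.
Qed.

Lemma sum_cliques_through1 A x k i :
  \sum_(j | j != i) cliques_through A x k j i = k.-1%:R * cliques_at A x k i.
Proof.
rewrite /cliques_through
  (exchange_big_dep (fun M : {set 'I_n} => (#|M| == k) && (i \in M))) /=;
  last by move=> j M _ /and3P[-> _ ->].
rewrite /cliques_at mulr_sumr; apply: eq_bigr => M /andP[/eqP cM iM].
rewrite (eq_bigl (fun j => j \in M :\ i)) => [|j].
  by rewrite sumr_const -cM (cardsD1 i M) iM mulr_natl.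
by rewrite cM eqxx iM andbT !inE.
Qed.

Lemma clique_weight_ge0 A x M :
  (forall E : {set 'I_n}, #|E| = 2%N -> A E \in `[0, 1]) ->
  (forall i, 0 <= x i) -> 0 <= clique_weight A x M.
Proof.
move=> A01 x0; rewrite mulr_ge0 ?prodr_ge0 // => E /andP[_ /eqP /A01].
by rewrite in_itv /= => /andP[].
Qed.

Lemma cliques_ge0 A x k :
  (forall E : {set 'I_n}, #|E| = 2%N -> A E \in `[0, 1]) ->
  (forall i, 0 <= x i) -> 0 <= cliques A x k.
Proof. by move=> A01 x0; apply: sumr_ge0 => M _; exact: clique_weight_ge0. Qed.

Lemma link_cliques_ge0 A x k i :
  (forall E : {set 'I_n}, #|E| = 2%N -> A E \in `[0, 1]) ->
  (forall i, 0 <= x i) -> 0 <= link_cliques A x k i.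
Proof.
move=> A01 x0; apply: sumr_ge0 => M _; rewrite mulr_ge0 ?clique_weight_ge0 //.
by rewrite prodr_ge0 // => j _; have /andP[] := adj_itv A01 i j.
Qed.

Lemma clique_weight_scale A x (y : 'I_n -> R) M :
  clique_weight A (fun j => x j * y j) M = clique_weight A x M * \prod_(j in M) y j.
Proof. by rewrite /clique_weight big_split mulrA. Qed.

(** With [c] the inverse of the degree of [i], the link becomes a weighted graph on the same
    vertices, so the induction can keep [n] fixed. *)
Lemma cliques_link A x k i (c : R) :
  cliques A (fun j => x j * (adj A i j * c)) k = c ^+ k * link_cliques A x k i.
Proof.
rewrite mulr_sumr; apply: eq_bigr => M /eqP cM.
by rewrite clique_weight_scale big_split /= prodr_const cM; ring.
Qed.

Lemma eq_clique_weight A x (y : 'I_n -> R) M : {in M, x =1 y} ->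
  clique_weight A x M = clique_weight A y M.
Proof. by move=> xy; congr (_ * _); apply: eq_bigr. Qed.

Lemma cliques_move A x k i (t : R) :
  cliques A (fun j => (1 - t) * x j + t * (j == i)%:R) k.+1 =
  (1 - t) ^+ k.+1 * cliques A x k.+1 + t * (1 - t) ^+ k * link_cliques A x k i.
Proof.
set y := fun j => _.
(* Away from [i] all weights shrink by [1 - t]; this applies to the cliques avoiding [i] and to the
   links of those through [i]. *)
have wE N : i \notin N ->
    clique_weight A y N = (1 - t) ^+ #|N| * clique_weight A x N.
  move=> iN; rewrite (@eq_clique_weight _ _ (fun j => x j * (1 - t))) => [|j jN].
    by rewrite clique_weight_scale prodr_const mulrC.
  rewrite /y; have [ji|_] := eqVneq j i; first by rewrite -ji jN in iN.
  by rewrite mulr0 addr0 mulrC.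
have splitE z : cliques A z k.+1 =
    z i * link_cliques A z k i
    + \sum_(M : {set 'I_n} | (#|M| == k.+1) && (i \notin M)) clique_weight A z M.
  by rewrite -cliques_atE /cliques (bigID (fun M : {set 'I_n} => i \in M)).
have -> : cliques A y k.+1 = ((1 - t) * x i + t) * ((1 - t) ^+ k * link_cliques A x k i)
    + (1 - t) ^+ k.+1 *
      \sum_(M : {set 'I_n} | (#|M| == k.+1) && (i \notin M)) clique_weight A x M.
  rewrite splitE; congr (_ * _ + _); first by rewrite /y eqxx mulr1.
    rewrite !link_cliquesE mulr_sumr; apply: eq_bigr => N /andP[/eqP cN iN].
    by rewrite wE // cN -mulrA.
  by rewrite mulr_sumr; apply: eq_bigr => N /andP[/eqP cN iN]; rewrite wE // cN.
by rewrite splitE exprS; ring.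
Qed.

(** Edge weights are only lowered, which never leaves [[0, 1]]. A clique contains the edge at most
    once, so clique sums are affine in [t]. *)
Definition damp A i j (t : R) : {set 'I_n} -> R :=
  fun E => if E == [set i; j] then (1 - t) * A E else A E.

Lemma cliques_damp A x k i j t : i != j ->
  cliques (damp A i j t) x k = cliques A x k - t * cliques_through A x k i j.
Proof.
move=> ij; rewrite /cliques /cliques_through.
rewrite (bigID (fun M : {set 'I_n} => [set i; j] \subset M)) /=.
rewrite [in RHS](bigID (fun M : {set 'I_n} => [set i; j] \subset M)) /=.
rewrite addrAC; congr (_ + _); last first.
  apply: eq_bigr => M /andP[_ ijM]; congr (_ * _); apply: eq_bigr => E /andP[EM _].
  by rewrite /damp ifN //; apply: contraNneq ijM => <-.
rewrite mulr_sumr [X in _ - X](eq_bigl (fun M : {set 'I_n} =>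
  (#|M| == k) && ([set i; j] \subset M))) => [|M]; last by rewrite subUset !sub1set.
rewrite -sumrB; apply: eq_bigr => M /andP[_ ijM].
have ij2 : ([set i; j] \subset M) && (#|[set i; j]| == 2%N) by rewrite ijM cards2 ij.
rewrite /clique_weight (bigD1 [set i; j]) ?ij2 //= [in RHS](bigD1 [set i; j]) ?ij2 //=.
rewrite /damp eqxx (eq_bigr A) => [|E /andP[_ /negPf ->] //].
by ring.
Qed.

(** The second-order bound, with the sum over pairs written through power sums. The first
    inequality, the union bound, is what carries the second through the induction. *)
Lemma bonferroni (I : Type) (s : seq I) (z : I -> R) :
  (forall i, 0 <= z i <= 1) ->
  (1 - \prod_(i <- s) (1 - z i) <= \sum_(i <- s) z i) /\
  (\prod_(i <- s) (1 - z i) - 1 + \sum_(i <- s) z i <=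
   ((\sum_(i <- s) z i) ^+ 2 - \sum_(i <- s) z i ^+ 2) / 2).
Proof.
move=> z01; elim: s => [|i s [IH1 IH2]].
  by rewrite !big_nil; split; lra.
rewrite !big_cons; have /andP[zi0 zi1] := z01 i.
have p1 : \prod_(i <- s) (1 - z i) <= 1.
  elim: {IH1 IH2} s => [|j s IH]; first by rewrite big_nil.
  rewrite big_cons; have /andP[zj0 zj1] := z01 j.
  by rewrite mulr_ile1 ?subr_ge0 ?gerBl // prodr_ge0 // => k _;
    have /andP[] := z01 k; rewrite subr_ge0.
move: (\prod_(i <- s) _) (\sum_(i <- s) z i) (\sum_(i <- s) _) IH1 IH2 p1.
move=> p a b IH1 IH2 p1; split; nra.
Qed.

End CliqueSums.

(** * Vertices missing a clique, and the Bonferroni estimate *)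

Section Gap.
Variables (R : realType) (n : nat).
Variables (A : {set 'I_n} -> R) (x : 'I_n -> R).
Hypothesis A01 : forall E : {set 'I_n}, #|E| = 2%N -> A E \in `[0, 1].
Hypothesis x_ge0 : forall i, 0 <= x i.
Hypothesis x_sum1 : \sum_i x i = 1.

(** With 0/1 edge weights, a vertex missing [j] vertices of a [k]-clique contributes in proportion
    to [max(j - 1, 0)]; the gap is thus 0 on complete multipartite graphs. *)
Definition clique_gap k := k.+1%:R * cliques A x k.+1
  + (k%:R - 1) * cliques A x k
  - \sum_i link_cliques A x 1 i * cliques_at A x k i.

Let nonadj v i := 1 - adj A v i.

Lemma clique_gapE k : clique_gap k =
  \sum_(M : {set 'I_n} | #|M| == k) clique_weight A x M *
    \sum_v x v * (\prod_(i in M) (1 - nonadj v i) - 1 + \sum_(i in M) nonadj v i).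
Proof.
have sumE (M : {set 'I_n}) : #|M| == k ->
    \sum_v x v * (\prod_(i in M) (1 - nonadj v i) - 1 + \sum_(i in M) nonadj v i)
    = \sum_v x v * \prod_(i in M) adj A v i + (k%:R - 1)
      - \sum_(i in M) link_cliques A x 1 i.
  move=> /eqP cM.
  transitivity (\sum_v (x v * \prod_(i in M) adj A v i + (k%:R - 1) * x v
                         - \sum_(i in M) x v * adj A v i)).
    apply: eq_bigr => v _.
    rewrite (eq_bigr (adj A v)) => [|i _]; last by rewrite /nonadj subKr.
    by rewrite sumrB sumr_const cM -mulr_sumr; ring.
  rewrite sumrB big_split /= -mulr_sumr x_sum1 mulr1 exchange_big /=.
  congr (_ - _); apply: eq_bigr => i _; rewrite link_cliques1.
  by apply: eq_bigr => v _; rewrite adjC.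
under eq_bigr => M cM do rewrite sumE // mulrBr mulrDr.
rewrite sumrB big_split /= sum_cliques_at; congr (_ - _).
rewrite -mulr_suml -/(cliques A x k) [X in _ + X]mulrC; congr (_ + _).
rewrite -sum_cliques_at1.
under eq_bigr => M _ do rewrite mulr_sumr.
rewrite exchange_big /=; apply: eq_bigr => v _; rewrite cliques_atE mulr_sumr.
by apply: eq_bigr => M _; rewrite mulrCA.
Qed.

Let pairs_sum (M : {set 'I_n}) (z : 'I_n -> R) :
  \sum_(i in M) \sum_(j in M | j != i) z i * z j =
  (\sum_(i in M) z i) ^+ 2 - \sum_(i in M) z i ^+ 2.
Proof.
rewrite expr2 mulr_suml -sumrB; apply: eq_bigr => i iM.
by rewrite mulr_sumr [in RHS](bigD1 i) //= -expr2 addrAC subrr add0r.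
Qed.

Let missing i j := \sum_v x v * (nonadj v i * nonadj v j) / 2.

Let nonadj_itv v i : 0 <= nonadj v i <= 1.
Proof. by have := adj_itv A01 v i; rewrite /nonadj; lra. Qed.

Let missing_sum (M : {set 'I_n}) :
  \sum_v x v * (((\sum_(i in M) nonadj v i) ^+ 2
                 - \sum_(i in M) nonadj v i ^+ 2) / 2) =
  \sum_(i in M) \sum_(j in M | j != i) missing i j.
Proof.
under [RHS]eq_bigr => i _ do rewrite exchange_big /=.
rewrite [RHS]exchange_big /=; apply: eq_bigr => v _.
rewrite -pairs_sum mulrA mulr_sumr mulr_suml; apply: eq_bigr => i _.
by rewrite mulr_sumr mulr_suml.
Qed.

Lemma clique_gap_le k : clique_gap k <=
  \sum_i \sum_(j | j != i) missing i j * cliques_through A x k i j.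
Proof.
rewrite clique_gapE -sum_cliques_through ler_sum // => M _.
rewrite ler_wpM2l ?clique_weight_ge0 // -missing_sum ler_sum // => v _.
rewrite ler_wpM2l // -!(big_enum _ _ M) /=.
by have [] := bonferroni (enum M) (nonadj_itv v).
Qed.

(** Bonferroni is an equality for two events. The same coefficients [missing] thus serve both gaps,
    and they are compared edge by edge. *)
Lemma clique_gap2 : clique_gap 2 =
  \sum_i \sum_(j | j != i) missing i j * cliques_through A x 2 i j.
Proof.
rewrite clique_gapE -sum_cliques_through; apply: eq_bigr => M cM.
congr (_ * _); rewrite -missing_sum; apply: eq_bigr => v _; congr (_ * _).
move: cM => /cards2P[i [j [ij ->]]].
rewrite !(big_setU1 i) ?inE //= !big_set1.
by field.
Qed.

Lemma clique_gap_mono k (lam : R) :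
  (forall i j, i != j ->
     cliques_through A x k i j <= lam * cliques_through A x 2 i j) ->
  clique_gap k <= lam * clique_gap 2.
Proof.
move=> Q; apply: le_trans (clique_gap_le k) _; rewrite clique_gap2 mulr_sumr.
apply: ler_sum => i _; rewrite mulr_sumr; apply: ler_sum => j ji.
rewrite mulrCA ler_wpM2l ?Q // 1?eq_sym //; apply: sumr_ge0 => v _.
by rewrite divr_ge0 // !mulr_ge0 //; have /andP[] := nonadj_itv v i;
  have /andP[] := nonadj_itv v j.
Qed.

End Gap.

(** * Critical weighted graphs *)

(** Asking only for some tangent of scallop [q] makes the claim meaningful at every edge density.
    The upper limit on [v] is what the slope comparison of [turan_tangent_step] needs. *)
Definition scallop_bound (R : realType) (n m q : nat) :=
  forall (A : {set 'I_n} -> R) (x : 'I_n -> R),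
    (forall E : {set 'I_n}, #|E| = 2%N -> A E \in `[0, 1]) ->
    (forall i, 0 <= x i) -> \sum_i x i = 1 ->
  exists2 v, q.+2%:R^-1 <= v <= q.+1%:R^-1 &
    'C(q, m)%:R * turan_tangent m q v (cliques A x 2) <= cliques A x m.+2.

Section Critical.
Variables (R : realType) (n m q : nat).
Variables (A : {set 'I_n} -> R) (x : 'I_n -> R).
Hypothesis A01 : forall E : {set 'I_n}, #|E| = 2%N -> A E \in `[0, 1].
Hypothesis x_ge0 : forall i, 0 <= x i.
Hypothesis le_mq : (m <= q)%N.
Hypothesis bound_m : scallop_bound R n m q.
Hypothesis bound_q : scallop_bound R n m.+1 q.

Let C : R := 'C(q.+1, m.+1)%:R.

(** The link of [i], normalised to total weight 1, is compared with parts of size [u / d]. Scaling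
    back by [d ^+ m.+3] leaves a bound that is affine in [d] and in the number of edges of the
    link. *)
Lemma link_bound i u (d := link_cliques A x 1 i) : 0 < d -> d <= q.+2%:R * u ->
  link_cliques A x m.+2 i <=
    C * (u ^+ m.+1 * d - m.+1%:R * q.+2%:R / m.+2%:R * u ^+ m.+2) ->
  C * u ^+ m.+1 * (link_cliques A x 2 i
    - m.+1%:R * q.+2%:R / m.+2%:R * u * d
    + m.+1%:R * q.+2%:R * q.+3%:R / (2 * m.+3%:R) * u ^+ 2)
  <= link_cliques A x m.+3 i.
Proof.
move=> d0 du Hm; set e := link_cliques A x 2 i.
have dN0 : d != 0 by rewrite gt_eqF.
pose y := fun j => x j * (adj A i j * d^-1).
have y_ge0 j : 0 <= y j.
  by rewrite !mulr_ge0 ?invr_ge0 ?(ltW d0) //; have /andP[] := adj_itv A01 i j.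
have y_sum1 : \sum_j y j = 1.
  by under eq_bigr => j _ do rewrite /y mulrA;
     rewrite -mulr_suml -link_cliques1 divff.
have yE k : cliques A y k = link_cliques A x k i / d ^+ k.
  by rewrite cliques_link exprVn mulrC.
set b := u / d.
have qb : q.+2%:R^-1 <= b.
  by rewrite -[leLHS]mul1r ler_pdivrMr ?ltr0n // /b mulrAC ler_pdivlMr // mul1r mulrC.
have [w /andP[qw wq]] := bound_m A01 y_ge0 y_sum1; rewrite !yE => Hw.
have C0 : 0 < 'C(q, m)%:R :> R by rewrite ltr0n bin_gt0.
(* The hypothesis bounds the cliques of the normalised link by the value of curve [q] at [b].
   Tangents increase, so a higher edge density would contradict [bound_m]. *)
have le_e : e / d ^+ 2 <= turan_edges q b.
  rewrite leNgt; apply/negP => lt_e.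
  have CE : 'C(q, m)%:R = C * m.+1%:R / q.+1%:R :> R.
    rewrite /C -natrM mulnC -mul_bin_diag natrM mulrC mulKf //.
    by rewrite pnatr_eq0.
  have : 'C(q, m)%:R * turan_tangent m q w (e / d ^+ 2) <=
         'C(q, m)%:R * turan_tangent m q b (turan_edges q b).
    apply: le_trans Hw _; rewrite ler_pdivrMr ?exprn_gt0 //.
    apply: le_trans Hm _; rewrite le_eqVlt; apply/orP; left; apply/eqP.
    rewrite CE /turan_tangent /turan_edges /b !expr_div_n.
    rewrite !(exprS u m.+1) !(exprS u m) !(exprS d m.+1) !(exprS d m).
    by field; rewrite ?expf_neq0 // -?natrD ?nat1r ?pnatr_eq0 ?dN0.
  rewrite ler_pM2l // (turan_tangent_affine _ _ w (turan_edges q b)).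
  apply/negP; rewrite -ltNge; apply: (le_lt_trans (turan_tangent_min m qw qb)).
  rewrite ltrDl mulr_gt0 ?subr_gt0 // exprn_gt0 //.
  by apply: lt_le_trans qw; rewrite invr_gt0 ltr0n.
have [v qv] := bound_q A01 y_ge0 y_sum1; rewrite !yE => Hv.
have := le_trans (turan_tangent_step m.+1 qb le_e qv) Hv.
rewrite ler_pdivlMr ?exprn_gt0 //; apply: le_trans.
rewrite le_eqVlt; apply/orP; left; apply/eqP; rewrite -/C.
rewrite /turan_tangent /b !expr_div_n.
rewrite !(exprS u m.+2) !(exprS u m.+1) !(exprS u m).
rewrite !(exprS d m.+2) !(exprS d m.+1) !(exprS d m).
by field; rewrite ?expf_neq0 // -?natrD ?nat1r ?pnatr_eq0 ?dN0.
Qed.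

Let K := cliques A x.
Let g : R := K 2.
Let b := turan_part q.+1 g.
Let lam := C * b ^+ m.+1.
(** The value forced by summing the vertex condition over all vertices. *)
Let c := m.+3%:R * K m.+3 - 2 * lam * g.
Let d i := link_cliques A x 1 i.
Hypothesis x_sum1 : \sum_i x i = 1.

Lemma critical_bound :
  (forall i j, i != j ->
     cliques_through A x m.+3 i j <= lam * cliques_through A x 2 i j) ->
  (forall i, cliques_at A x m.+3 i = lam * cliques_at A x 2 i + c * x i) ->
  C * turan_tangent m.+1 q.+1 b g <= K m.+3.
Proof.
move=> Hedge Hvertex; rewrite leNgt; apply/negP => ltK.
have C0 : 0 < C by rewrite ltr0n bin_gt0.
have qb : q.+3%:R^-1 <= b by exact: turan_part_ge.
have b0 : 0 < b by apply: lt_le_trans qb; rewrite invr_gt0 ltr0n.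
have lam0 : 0 < lam by rewrite mulr_gt0 ?exprn_gt0.
have lamN0 : lam != 0 by rewrite gt_eqF.
pose w : R := m.+1%:R * q.+2%:R / m.+2%:R.
have w0 : 0 < w by rewrite divr_gt0 ?mulr_gt0 ?ltr0n.
(* [u] is chosen so that, up to the factor [lam / (C * u ^+ m.+1) <= 1], the
   vertex condition is that of the extremal graph with parts of size [u]. *)
pose u := (2 * g - m.+3%:R * K m.+3 / lam) / w.
have cE : c = - (lam * w * u).
  by rewrite /c /u; field; rewrite lamN0 gt_eqF.
(* Summing the edge condition over the edges at [i] and inserting the vertex condition bounds the
   degree of every vertex of positive weight. *)
have deg_le i : x i * d i <= x i * (q.+2%:R * u).
  have H : m.+2%:R * cliques_at A x m.+3 i <= lam * cliques_at A x 2 i.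
    have := sum_cliques_through1 A x m.+3 i; rewrite /= => <-.
    have := sum_cliques_through1 A x 2 i; rewrite mul1r => <-.
    by rewrite mulr_sumr; apply: ler_sum => j ji; exact: Hedge.
  move: H; rewrite Hvertex cliques_atE -/(d i) cE -subr_ge0.
  have -> : lam * (x i * d i) -
      m.+2%:R * (lam * (x i * d i) + - (lam * w * u) * x i) =
      lam * m.+1%:R * (x i * (q.+2%:R * u) - x i * d i).
    by rewrite /w; field; rewrite -?natrD ?nat1r ?pnatr_eq0.
  by rewrite pmulr_rge0 ?subr_ge0 // mulr_gt0 ?ltr0n.
have sum_deg : \sum_i x i * d i = 2 * g.
  rewrite -sum_cliques_at1; apply: eq_bigr => i _.
  by rewrite cliques_atE.
have le_gu : 2 * g <= q.+2%:R * u.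
  have -> : q.+2%:R * u = \sum_i x i * (q.+2%:R * u).
    by rewrite -mulr_suml x_sum1 mul1r.
  rewrite -sum_deg.
  by apply: ler_sum => i _; exact: deg_le.
(* On the curve, equality in [ltK] would give [u = b], so a smaller clique sum gives [b < u]. Beyond
   the maximal density, [le_gu] alone makes [u] large enough. *)
have [bu lt_g] : b <= u /\ turan_edges q.+1 u < g.
  have : b = turan_part q.+1 g by [].
  case: turan_partP => [v qv gE vE|lt_g vE]; rewrite vE in ltK *.
    suff vu : v < u.
      by split; [exact: ltW|rewrite gE; exact: turan_edges_decr].
    rewrite /u ltr_pdivlMr // ltrBrDr -ltrBrDl ltr_pdivrMr //.
    apply: (@lt_le_trans _ _ (m.+3%:R * (C * turan_tangent m.+1 q.+1 v g))).
      by rewrite ltr_pM2l ?ltr0n.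
    rewrite le_eqVlt; apply/orP; left; apply/eqP.
    rewrite /lam vE gE /w /turan_tangent /turan_edges.
    rewrite (exprS v m.+2) (exprS v m.+1).
    by field; rewrite -?natrD ?nat1r ?pnatr_eq0.
  suff vu : q.+3%:R^-1 <= u.
    by split=> //; apply: le_lt_trans lt_g; exact: turan_edges_le.
  rewrite -(ler_pM2l (_ : 0 < q.+2%:R)) ?ltr0n //.
  apply: le_trans le_gu; rewrite -ler_pdivrMl ?ltr0n //; apply: ltW.
  apply: le_lt_trans lt_g; rewrite turan_edges_inv le_eqVlt; apply/orP; left.
  by apply/eqP; field; rewrite -?natrD ?nat1r ?pnatr_eq0.
have u0 : 0 < u by apply: lt_le_trans bu.
have lam_le : lam <= C * u ^+ m.+1.
  by rewrite ler_pM2l // lerXn2r // nnegrE ltW.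
pose X i := link_cliques A x 2 i - w * u * d i
    + m.+1%:R * q.+2%:R * q.+3%:R / (2 * m.+3%:R) * u ^+ 2.
have link_le i : x i * (lam * X i) <= x i * link_cliques A x m.+3 i.
  have [xi0|xi_neq0] := eqVneq (x i) 0; first by rewrite xi0 !mul0r.
  have xi0 : 0 < x i by rewrite lt_neqAle eq_sym xi_neq0 x_ge0.
  have le_du : d i <= q.+2%:R * u by have := deg_le i; rewrite ler_pM2l.
  have linkE : link_cliques A x m.+2 i = lam * (d i - w * u).
    apply: (mulfI xi_neq0); rewrite -cliques_atE Hvertex cliques_atE -/(d i) cE.
    by ring.
  have dw0 : 0 <= d i - w * u.
    by rewrite -(pmulr_rge0 _ lam0) -linkE link_cliques_ge0.
  have d0 : 0 < d i.
    by apply: (@lt_le_trans _ _ (w * u)); [exact: mulr_gt0|rewrite -subr_ge0].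
  rewrite ler_pM2l //.
  have Hlink : C * u ^+ m.+1 * X i <= link_cliques A x m.+3 i.
    apply: link_bound => //; rewrite linkE.
    apply: (@le_trans _ _ (C * u ^+ m.+1 * (d i - w * u))).
      by rewrite ler_wpM2r.
    rewrite le_eqVlt; apply/orP; left; apply/eqP.
    by rewrite /w (exprS u m.+1) /d; ring.
  (* Replacing [C * u ^+ m.+1] by the smaller [lam] is sound only for [X i >= 0]; otherwise the
     bound is negative and holds trivially. *)
  have [X0|X0] := leP 0 (X i).
    by apply: le_trans Hlink; rewrite ler_wpM2r.
  by apply: le_trans (link_cliques_ge0 _ _ A01 x_ge0); rewrite nmulr_lle0 // ltW.
have sumX : lam * (3 * K 3 - w * u * (2 * g)
    + m.+1%:R * q.+2%:R * q.+3%:R / (2 * m.+3%:R) * u ^+ 2) <= m.+4%:R * K m.+4.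
  rewrite -(sum_cliques_at1 A x m.+4).
  under [leRHS]eq_bigr => i _ do rewrite cliques_atE.
  apply: le_trans (ler_sum _ (fun i _ => link_le i)).
  rewrite -sum_deg -(sum_cliques_at1 A x 3) le_eqVlt; apply/orP; left; apply/eqP.
  have -> : m.+1%:R * q.+2%:R * q.+3%:R / (2 * m.+3%:R) * u ^+ 2 =
      \sum_i x i * (m.+1%:R * q.+2%:R * q.+3%:R / (2 * m.+3%:R) * u ^+ 2).
    by rewrite -mulr_suml x_sum1 mul1r.
  rewrite mulr_sumr -sumrB -big_split /= mulr_sumr.
  by apply: eq_bigr => i _; rewrite cliques_atE /X; ring.
have := clique_gap_mono A01 x_ge0 x_sum1 Hedge; rewrite /clique_gap.
have -> : \sum_i link_cliques A x 1 i * cliques_at A x m.+3 i =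
    lam * (\sum_i link_cliques A x 1 i * cliques_at A x 2 i) + c * (2 * g).
  rewrite -sum_deg !mulr_sumr -big_split /=; apply: eq_bigr => i _.
  by rewrite Hvertex /d; ring.
rewrite -/(K 3) -/(K 2) -/g -/(K m.+3) -/(K m.+4).
set S := \sum_i _ => gap.
have KE : K m.+3 = lam * (2 * g - w * u) / m.+3%:R.
  have -> : lam * (2 * g - w * u) = c + 2 * lam * g by rewrite cE; ring.
  by rewrite /c; field; rewrite -?natrD ?nat1r ?pnatr_eq0.
(* The terms [K 3] and [S] cancel between [sumX] and the gap inequality; what remains contradicts
   [lt_g]. *)
have : lam * (m.+1%:R / m.+3%:R) * (g - turan_edges q.+1 u) <= 0.
  apply: le_trans (_ : lam * (3 * K 3 - w * u * (2 * g)
    + m.+1%:R * q.+2%:R * q.+3%:R / (2 * m.+3%:R) * u ^+ 2)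
    + (m.+3%:R - 1) * K m.+3 - (lam * S + c * (2 * g))
    - lam * (3 * K 3 + (2 - 1) * g - S) <= 0); last first.
    by rewrite subr_le0; apply: le_trans gap; rewrite !lerD2r.
  rewrite le_eqVlt; apply/orP; left; apply/eqP.
  rewrite KE cE /turan_edges /w.
  by field; rewrite -?natrD ?nat1r ?pnatr_eq0.
by rewrite leNgt mulr_gt0 ?subr_gt0 // mulr_gt0 // divr_gt0 ?ltr0n.
Qed.

End Critical.

(** * Minimisers and first-order conditions *)

From mathcomp Require Import classical_sets set_interval topology normedtype.
From mathcomp Require Import derive realfun.

Import numFieldNormedType.Exports.

Lemma ge0_at_origin (R : realType) (F : R -> R) : {for 0, continuous F} ->
  (forall t, 0 < t <= 1 -> 0 <= F t) -> 0 <= F 0.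
Proof.
move=> cF F0; rewrite leNgt; apply/negP => ltF.
have /(nbhs_ballP (0 : R)) [e /= e0 He] : nbhs (0 : R) (fun t => F t < 0).
  exact: cvgr_lt cF _ ltF.
have e2 : 0 < Num.min 1 (e / 2) by rewrite lt_min ltr01 divr_gt0.
have := He (Num.min 1 (e / 2)); rewrite ltNge F0 ?e2 ?ge_min ?lexx //.
move=> /(_ _)/negP; rewrite -ball_normE /= sub0r normrN gtr0_norm //.
by rewrite gt_min ltr_pdivrMr // ltr_pMr // ltr1n orbT; apply.
Qed.

Section Minimiser.
Import ArrowAsProduct.
Variables (R : realType) (n : nat).

Let point := ('I_n + {set 'I_n})%type -> R^o.
Let edges (z : point) (E : {set 'I_n}) : R := z (inr E).
Let weights (z : point) (i : 'I_n) : R := z (inl i).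

Let continuous_coord i : continuous (fun z : point => z i : R^o).
Proof. exact: proj_continuous. Qed.

Let continuous_cliques k :
  continuous (fun z : point => cliques (edges z) (weights z) k : R^o).
Proof.
apply: continuous_big => [|M _]; first exact: add_continuous.
have prod_continuous (I : finType) (P : pred I) (f : I -> 'I_n + {set 'I_n}) :
    continuous (fun z : point => \prod_(i | P i) (z (f i) : R^o) : R^o).
  apply: (@continuous_big R^o I *%R 1) => [|i _]; first exact: mul_continuous.
  exact: continuous_coord.
move=> z; rewrite /clique_weight.
exact: (cvgM (prod_continuous _ _ inr z) (prod_continuous _ _ inl z)).
Qed.

Let eq_cliques (A B : {set 'I_n} -> R) x k :
  (forall E : {set 'I_n}, #|E| = 2%N -> A E = B E) ->
  cliques A x k = cliques B x k.
Proof.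
move=> AB; apply: eq_bigr => M _; congr (_ * _).
by apply: eq_bigr => E /andP[_ /eqP /AB].
Qed.

Lemma clique_minimiser k (F : R -> R) (A0 : {set 'I_n} -> R) (x0 : 'I_n -> R) :
  continuous F ->
  (forall E : {set 'I_n}, #|E| = 2%N -> A0 E \in `[0, 1]) ->
  (forall i, 0 <= x0 i) -> \sum_i x0 i = 1 ->
  exists A x, [/\ forall E : {set 'I_n}, #|E| = 2%N -> A E \in `[0, 1],
    forall i, 0 <= x i, \sum_i x i = 1 &
    forall B y, (forall E : {set 'I_n}, #|E| = 2%N -> B E \in `[0, 1]) ->
      (forall i, 0 <= y i) -> \sum_i y i = 1 ->
      cliques A x k - F (cliques A x 2) <= cliques B y k - F (cliques B y 2)].
Proof.
move=> cF A01 x0_ge0 x0_sum.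
pose S : set point := ([set z : point | forall i, 0 <= z i <= 1] `&`
  [set z : point | \sum_i weights z i = 1])%classic.
(* Coordinates at sets that are not pairs do not affect clique sums; 0 there keeps the point in the
   compact set [S]. *)
pose pt (B : {set 'I_n} -> R) (y : 'I_n -> R) : point := fun s =>
  match s with inl i => y i | inr E => if #|E| == 2%N then B E else 0 end.
have ptS B y : (forall E : {set 'I_n}, #|E| = 2%N -> B E \in `[0, 1]) ->
    (forall i, 0 <= y i) -> \sum_i y i = 1 -> S (pt B y).
  move=> B01 y0 y1; split => //= -[i|E] /=.
    by rewrite y0 -y1 (bigD1 i) //= lerDl sumr_ge0.
  by case: eqP => [/B01|_]; rewrite ?in_itv //= lexx ler01.
have ptE B y j : cliques (edges (pt B y)) (weights (pt B y)) j = cliques B y j.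
  by apply: eq_cliques => E E2; rewrite /edges /= E2 eqxx.
pose phi (z : point) : R^o := cliques (edges z) (weights z) k
                       - F (cliques (edges z) (weights z) 2).
have cphi : continuous phi.
  move=> z; have c1 := @continuous_cliques k z.
  have c2 := @continuous_comp _ _ _ _ (F : R^o -> R^o) z
    (@continuous_cliques 2 z) (@cF _).
  exact: (cvgB c1 c2).
have cS : compact S.
  apply: compact_closedI.
    apply: (@tychonoff _ (fun=> R^o) (fun=> [set t | 0 <= t <= 1]%classic)) => i.
    by rewrite -set_itvcc; exact: segment_compact.
  apply: (@preimage_closed _ _ (fun z : point => \sum_i weights z i : R^o)
    [set x | x = 1]%classic) => [z _|];
    last exact: closed_eq.
  by apply: continuous_big => [|i _];
    [exact: add_continuous|exact: continuous_coord].
have S0 : (S !=set0)%classic by exists (pt A0 x0); exact: ptS.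
have [z /set_mem[/= z01 z1] zmin] :=
  compact_EVT_min S0 cS (continuous_subspaceT cphi).
exists (edges z), (weights z); split => // [E _|i|B y B01 y0 y1].
- exact: z01 (inr E).
- by have /andP[] := z01 (inl i).
have := zmin (pt B y); rewrite /phi !ptE; apply.
by apply/mem_set; exact: ptS.
Qed.

End Minimiser.

(** The difference quotient is a polynomial in [t], so its value at 0 is the derivative when weight
    is moved to [i]. *)
Lemma cliques_move_poly (R : realType) (n : nat) (A : {set 'I_n} -> R) x k i :
  exists2 p : {poly R}, p.[0] = link_cliques A x k i - k.+1%:R * cliques A x k.+1 &
  forall t, cliques A (fun j => (1 - t) * x j + t * (j == i)%:R) k.+1 =
    cliques A x k.+1 + t * p.[t].
Proof.
set L := link_cliques A x k i; set K := cliques A x k.+1.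
exists ((1 - 'X) ^+ k * L%:P - K%:P * \sum_(l < k.+1) (1 - 'X) ^+ l).
  rewrite hornerD hornerN !hornerM horner_sum !hornerC horner_exp !hornerE.
  rewrite subr0 expr1n mul1r.
  under eq_bigr => l _ do rewrite horner_exp !hornerE subr0 expr1n.
  by rewrite sumr_const card_ord mulrC.
move=> t; rewrite cliques_move -/L -/K.
rewrite hornerD hornerN !hornerM horner_sum !hornerC horner_exp !hornerE.
under eq_bigr => l _ do rewrite horner_exp !hornerE.
have := subrX1 (1 - t) k.+1; set S := \sum_(l < _) _ => SE.
have -> : (1 - t) ^+ k.+1 = 1 - t * S.
  by apply: (subIr 1); rewrite SE; ring.
by ring.
Qed.

Lemma continuous_turan_part (R : realType) q :
  continuous (@turan_part R q : R^o -> R^o).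
Proof.
move=> x.
have c1 : {for x, continuous (fun x : R^o => 1 - 2 * q.+2%:R / q.+1%:R * x : R^o)}.
  exact: (cvgB (cvg_cst _) (cvgM (cvg_cst _) cvg_id)).
have c2 := @continuous_comp _ _ _ _ (@Num.sqrt R) x c1 (@sqrt_continuous R _).
exact: (cvgM (cvgD (cvg_cst _) c2) (cvg_cst _)).
Qed.

(** * First-order conditions at a minimiser and the induction step *)

Section Descent.
Variables (R : realType) (n m q : nat).

Let C : R := 'C(q.+1, m.+1)%:R.
Let F (g : R) : R := C * turan_tangent m.+1 q.+1 (turan_part q.+1 g) g.

Let continuous_part_exp j :
  continuous (fun g : R^o => turan_part q.+1 g ^+ j : R^o).
Proof.
move=> g; exact: (@continuous_comp _ _ _ (@turan_part R q.+1 : R^o -> R^o)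
  (fun x => x ^+ j) g (@continuous_turan_part R q.+1 g) (@exprn_continuous R j _)).
Qed.

Let continuous_F : continuous (F : R^o -> R^o).
Proof.
move=> g.
pose e j := @continuous_part_exp j g.
apply: (cvgM (cvg_cst _)).
exact: (cvgD (cvgB (cvgM (e m.+1) cvg_id) (cvgM (cvg_cst _) (e m.+2)))
             (cvgM (cvg_cst _) (e m.+3))).
Qed.

(* [F] is an infimum of affine functions, so along a one-parameter family its
   increment is at least that of the affine function attaining it at the
   perturbed point; letting [t] tend to [0] gives the first-order condition. *)
Let first_order (K g : R) (p h : {poly R}) :
  (forall t, 0 < t <= 1 ->
     K - F g <= K + t * p.[t] - F (g + t * h.[t])) ->
  C * turan_part q.+1 g ^+ m.+1 * h.[0] <= p.[0].
Proof.
move=> Hmin; rewrite -subr_ge0.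
pose G (t : R) := p.[t] - C * turan_part q.+1 (g + t * h.[t]) ^+ m.+1 * h.[t].
suff : 0 <= G 0 by rewrite /G mul0r addr0.
apply: ge0_at_origin => [|t /andP[t0 t1]].
  have ch := @continuous_horner R h 0.
  have c1 : {for (0 : R), continuous (fun t : R => g + t * h.[t] : R^o)}.
    exact: (cvgD (cvg_cst _) (cvgM cvg_id ch)).
  have c2 := @continuous_comp _ _ _ _ (fun g : R^o => turan_part q.+1 g ^+ m.+1 : R^o) 0
    c1 (@continuous_part_exp m.+1 _).
  exact: (cvgB (@continuous_horner R p 0) (cvgM (cvgM (cvg_cst _) c2) ch)).
rewrite /G; set v := turan_part _ _.
have := Hmin t; rewrite t0 t1 => /(_ isT).
have : F g <= C * turan_tangent m.+1 q.+1 v g.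
  by rewrite ler_wpM2l ?turan_tangent_part_min ?turan_part_ge ?ler0n.
rewrite /F -/v (turan_tangent_affine _ _ v g (g + t * h.[t])).
move=> H1 H2; rewrite -(pmulr_rge0 _ t0).
have -> : t * (p.[t] - C * v ^+ m.+1 * h.[t]) =
  (K + t * p.[t] - C * (turan_tangent m.+1 q.+1 v g + v ^+ m.+1 * (g + t * h.[t] - g)))
  - (K - C * turan_tangent m.+1 q.+1 v g) by ring.
by rewrite subr_ge0; apply: le_trans H2; rewrite lerD2l lerN2.
Qed.

Hypothesis le_mq : (m <= q)%N.
Hypothesis bound_m : scallop_bound R n m q.
Hypothesis bound_q : scallop_bound R n m.+1 q.

Lemma turan_part_bound (A : {set 'I_n} -> R) (x : 'I_n -> R) :
  (forall E : {set 'I_n}, #|E| = 2%N -> A E \in `[0, 1]) ->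
  (forall i, 0 <= x i) -> \sum_i x i = 1 ->
  C * turan_tangent m.+1 q.+1 (turan_part q.+1 (cliques A x 2)) (cliques A x 2)
  <= cliques A x m.+3.
Proof.
move=> A01 x_ge0 x_sum.
have [B [y [B01 y_ge0 y_sum Hmin]]] :=
  clique_minimiser m.+3 continuous_F A01 x_ge0 x_sum.
rewrite -subr_ge0; apply: le_trans (Hmin A x A01 x_ge0 x_sum).
rewrite subr_ge0; apply: critical_bound => // [i j ij|i].
  (* Damping the edge [ij] changes both clique sums linearly, hence the constant polynomials. *)
  have := @first_order (cliques B y m.+3) (cliques B y 2)
    (- cliques_through B y m.+3 i j)%:P (- cliques_through B y 2 i j)%:P.
  rewrite !hornerC mulrN lerN2; apply=> t /andP[t0 t1]; rewrite !hornerC !mulrN.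
  rewrite -!cliques_damp //; apply: Hmin => // E E2; rewrite /damp.
  have := B01 E E2; rewrite !in_itv /= => /andP[BE0 BE1].
  case: ifP => _; last by rewrite BE0.
  by rewrite mulr_ge0 ?mulr_ile1 ?subr_ge0 // gerBl ltW.
set c := _ - _.
pose gap j := link_cliques B y m.+2 j
  - (C * turan_part q.+1 (cliques B y 2) ^+ m.+1 * link_cliques B y 1 j + c).
have gap_ge0 j : 0 <= gap j.
  have [p p0 pE] := cliques_move_poly B y m.+2 j.
  have [h h0 hE] := cliques_move_poly B y 1 j.
  have := @first_order (cliques B y m.+3) (cliques B y 2) p h.
  rewrite p0 h0 -subr_ge0 => H.
  rewrite (_ : gap j = link_cliques B y m.+2 j - m.+3%:R * cliques B y m.+3
    - C * turan_part q.+1 (cliques B y 2) ^+ m.+1 *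
      (link_cliques B y 1 j - 2 * cliques B y 2)); last by rewrite /gap /c; ring.
  apply: H => t /andP[t0 t1]; rewrite -pE -hE; apply: Hmin => // [k|].
    by rewrite addr_ge0 // mulr_ge0 ?subr_ge0 // ltW.
  rewrite big_split /= -!mulr_sumr y_sum.
  rewrite (bigD1 j) //= eqxx big1 => [|k /negPf -> //].
  by rewrite addr0 !mulr1 subrK.
(* Complementary slackness: [c] makes the weighted mean of the nonnegative [gap] zero, so each term
   vanishes. *)
have gap_sum : \sum_j y j * gap j = 0.
  rewrite /gap; under eq_bigr => j _.
    rewrite mulrBr mulrDr mulrCA -!cliques_atE; over.
  rewrite sumrB big_split /= -mulr_sumr -mulr_suml y_sum !sum_cliques_at1 /c.
  by ring.
have : y i * gap i = 0.
  by apply: (psumr_eq0P _ gap_sum) => // j _; rewrite mulr_ge0.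
rewrite !cliques_atE /gap => /eqP; rewrite mulrBr subr_eq0 => /eqP ->.
by ring.
Qed.

Lemma scallop_bound_step : scallop_bound R n m.+1 q.+1.
Proof.
move=> A x A01 x_ge0 x_sum; have := turan_part_bound A01 x_ge0 x_sum.
set g := cliques A x 2; set K := cliques _ _ _.
have inv_le : q.+3%:R^-1 <= q.+2%:R^-1 :> R by rewrite lef_pV2 ?posrE ?ltr0n // ler_nat.
case: turan_partP => [v qv gE le_K|_ le_K]; last by exists q.+3%:R^-1; rewrite ?lexx.
have [vq|qv2] := leP v q.+2%:R^-1; first by exists v => //; rewrite qv.
(* The density lies to the left of scallop [q.+1]. The tangent at its left end is there below every
   tangent of scallop [q], so [bound_q] suffices. *)
exists q.+2%:R^-1; first by rewrite inv_le lexx.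
have [w qw] := bound_q A01 x_ge0 x_sum; apply: le_trans.
apply: turan_tangent_step qw => //.
suff -> : turan_edges q q.+2%:R^-1 = turan_edges q.+1 q.+2%:R^-1 :> R.
  by rewrite -/g gE; apply: turan_edges_le => //; exact: ltW.
by rewrite /turan_edges; field; rewrite -?natrD ?nat1r ?pnatr_eq0.
Qed.

End Descent.

(** * The double induction and the theorem *)

Lemma clique_scallop_bound (R : realType) (n m q : nat) : scallop_bound R n m q.
Proof.
(* The pair [(m.+1, q.+1)] rests on [(m, q)] and [(m.+1, q)]. For [m = 0] every tangent is the
   identity; for [q < m] the binomial coefficient is 0. *)
elim: m q => [|m IHm] q.
  move=> A x _ _ _; exists q.+2%:R^-1; last first.
    by rewrite bin0 mul1r /turan_tangent !mul0r subr0 addr0 expr0 mul1r.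
  by rewrite lexx lef_pV2 ?posrE ?ltr0n ?ler_nat ?leqnSn.
have small k : (k < m.+1)%N -> scallop_bound R n m.+1 k.
  move=> lt_km A x A01 x_ge0 _; exists k.+2%:R^-1.
    by rewrite lexx lef_pV2 ?posrE ?ltr0n ?ler_nat ?leqnSn.
  by rewrite bin_small // mul0r cliques_ge0.
elim: q => [|q IHq]; first exact: small.
have [le_mq|lt_qm] := leqP m q; first exact: scallop_bound_step.
exact: small.
Qed.

Theorem theorem5p1 (R : realType) (n : nat) (G : wgraph R n) (r : nat)
    (hr : (2 <= r)%N) (gamma : R) (hgamma : gamma = clique_density G 2)
    (s : nat) (hs : (0 < s)%N)
    (hgamma_s : gamma \in `[(s%:R - 1) / (2 * s%:R), s%:R / (2 * (s%:R + 1))])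
    (alpha : R) (halpha : alpha \in `[0, s%:R^-1])
    (hgamma_alpha : gamma = s%:R / (2 * (s%:R + 1)) * (1 - alpha ^+ 2)) :
  1 / (s%:R + 1) ^+ r * 'C(s.+1, r)%:R * (1 + alpha) ^+ r.-1
    * (1 - (r%:R - 1) * alpha) <= clique_density G r.
Proof.
move: r hr s hs hgamma_s halpha hgamma_alpha.
move=> [|[|m]] // _ [//|q] _ _; rewrite in_itv /= => /andP[alpha0 _] gammaE.
have [v /andP[qv _] le_K] := clique_scallop_bound m q (@eweight_itv _ _ G)
  (@vweight_ge0 _ _ G) (vweight_sum1 G).
apply: le_trans le_K.
have -> : cliques (eweight G) (vweight G) 2 = gamma by rewrite hgamma.
(* The size of the [s] equal parts in the extremal graph of edge density [gamma]. *)
pose u := (1 + alpha) / q.+2%:R.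
have qu : q.+2%:R^-1 <= u.
  by rewrite ler_pdivlMr ?ltr0n // mulVf ?pnatr_eq0 // lerDl.
have uE : gamma = turan_edges q u.
  rewrite gammaE /turan_edges /u.
  by field; rewrite -?natrD ?nat1r ?pnatr_eq0.
have binE : 'C(q.+2, m.+2)%:R =
    q.+2%:R * q.+1%:R / (m.+2%:R * m.+1%:R) * 'C(q, m)%:R :> R.
  apply: (mulfI (_ : m.+2%:R * m.+1%:R != 0)).
    by rewrite mulf_neq0 ?pnatr_eq0.
  rewrite mulrA [RHS](_ : _ = q.+2%:R * q.+1%:R * 'C(q, m)%:R); last first.
    by field; rewrite -?natrD ?nat1r ?pnatr_eq0.
  rewrite -!natrM; congr _%:R.
  have h1 := mul_bin_diag q.+2 m.+1; have h2 := mul_bin_diag q.+1 m.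
  by rewrite mulnAC -h1 -!mulnA h2 [('C(_, _) * _)%N]mulnC.
apply: (@le_trans _ _ ('C(q, m)%:R * turan_tangent m q u gamma)); last first.
  by rewrite ler_wpM2l ?ler0n // uE turan_tangent_min.
rewrite le_eqVlt; apply/orP; left; apply/eqP.
rewrite uE /turan_tangent /turan_edges binE /u !expr_div_n natr1 /=.
rewrite !(exprS (1 + alpha) m.+1) !(exprS (1 + alpha) m).
rewrite !(exprS q.+2%:R m.+1) !(exprS q.+2%:R m).
by field; rewrite ?expf_neq0 -?natrD ?nat1r ?pnatr_eq0.
Qed.
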